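(* Let $m,n\in\mathbb{Z}$ with $\sqrt{m+ni}\notin\mathbb{Q}(i)$, where $\sqrt{m+ni}$ is a complex square root of $m+ni$. Let $\alpha=\sqrt{m+ni}-\lfloor\sqrt{m+ni}\rfloor_T$. Then the sequence $(\alpha^T_{(n)})$ produced from $\alpha$ by Tanaka's algorithm is purely periodic.
   Context: Let $X=\{u(1+i)+v(1-i): -1/2\le u,v<1/2\}$. For $z=u(1+i)+v(1-i)$ ($u,v\in\mathbb{R}$) let $\lfloor z\rfloor_T=\lfloor u+\tfrac12\rfloor(1+i)+\lfloor v+\tfrac12\rfloor(1-i)$ (so $z-\lfloor z\rfloor_T\in X$). Define $T_T:X\to X$ by $T_T(z)=1/z-\lfloor1/z\rfloor_T$ for $z\ne0$, $T_T(0)=0$. Tanaka's algorithm: $\alpha^T_{(1)}=\alpha$; if $\alpha^T_{(n)}\ne0$ then $\alpha^T_{(n+1)}=T_T(\alpha^T_{(n)})$; if $\alpha^T_{(n)}=0$ the sequence terminates. Purely periodic means the sequence is infinite and there is $l\ge1$ with $\alpha^T_{(n+l)}=\alpha^T_{(n)}$ for all $n\ge1$. *)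

(* Defs.v *)
From HB Require Import structures.
From mathcomp Require Import all_boot all_order all_algebra.
From mathcomp Require Import complex reals.
From mathcomp Require Import ring lra.
Set Implicit Arguments.
Unset Strict Implicit.
Unset Printing Implicit Defensive.
Import Order.TTheory GRing.Theory Num.Theory.
Local Open Scope ring_scope.
Local Open Scope complex_scope.

(* The real coordinates u, v of z = u (1 + i) + v (1 - i); see [coordTE]. *)
Definition uT (R : realType) (z : R[i]) : R := (complex.Re z + complex.Im z) / 2.
Definition vT (R : realType) (z : R[i]) : R := (complex.Re z - complex.Im z) / 2.

Lemma coordTE (R : realType) (z : R[i]) (u v : R) :
  z = u%:C * (1 + 'i) + v%:C * (1 - 'i) <-> u = uT z /\ v = vT z.
Proof.
rewrite /uT /vT; case: z => a b; split.
  by move=> /eqP; rewrite eq_complex /= => /andP[/eqP -> /eqP ->]; split; field.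
by move=> [-> ->]; apply/eqP; rewrite eq_complex /=; apply/andP; split;
  apply/eqP; field.
Qed.

Definition domX (R : realType) : pred R[i] :=
  fun z => (- (1 / 2) <= uT z < 1 / 2) && (- (1 / 2) <= vT z < 1 / 2).

Definition floorT (R : realType) (z : R[i]) : R[i] :=
  (Num.floor (uT z + 1 / 2))%:~R * (1 + 'i)
  + (Num.floor (vT z + 1 / 2))%:~R * (1 - 'i).

(* Defined on all of R[i]; only its restriction to [domX] matters, and it takes
   values there ([TT_domX]). *)
Definition TT (R : realType) (z : R[i]) : R[i] :=
  if z == 0 then 0 else z^-1 - floorT z^-1.

Lemma floorT_domX (R : realType) (z : R[i]) : domX (z - floorT z).
Proof.
pose u := (Num.floor (uT z + 1 / 2))%:~R : R.
pose v := (Num.floor (vT z + 1 / 2))%:~R : R.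
have E : z - floorT z = (uT z - u)%:C * (1 + 'i) + (vT z - v)%:C * (1 - 'i).
  have /coordTE zE : uT z = uT z /\ vT z = vT z by [].
  rewrite {1}zE /floorT -(rmorph_int (real_complex R) (Num.floor (uT z + _))).
  by rewrite -(rmorph_int (real_complex R) (Num.floor (vT z + _))) !rmorphB /=; ring.
have [eu ev] := (coordTE _ _ _).1 E.
have /andP[u1 u2] := floor_itv (uT z + 1 / 2).
have /andP[v1 v2] := floor_itv (vT z + 1 / 2).
move: u1 u2 v1 v2; rewrite !intrD -/u -/v => *.
by rewrite /domX -eu -ev; apply/andP; split; apply/andP; split; lra.
Qed.

Lemma TT_domX (R : realType) (z : R[i]) : domX (TT z).
Proof.
rewrite /TT; case: eqP => _; last exact: floorT_domX.
by rewrite /domX /uT /vT /=; lra.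
Qed.

(* Indexing from 0: [tanaka_seq a k] is the term alpha_(k+1) for alpha = a, or
   [None] if the sequence has terminated before reaching it. *)
Fixpoint tanaka_seq (R : realType) (a : R[i]) (k : nat) : option R[i] :=
  if k is k'.+1 then
    if tanaka_seq a k' is Some z then
      if z == 0 then None else Some (TT z)
    else None
  else Some a.

Definition purely_periodic (R : realType) (a : R[i]) : Prop :=
  (forall k, tanaka_seq a k <> None) /\
  exists2 l : nat, (1 <= l)%N &
    forall k, tanaka_seq a (k + l) = tanaka_seq a k.

Definition in_Qi (R : realType) (z : R[i]) : Prop :=
  exists p q : rat, z = ratr p +i* ratr q.

(* Main.v *)
Require Import Defs.
From HB Require Import structures.
From mathcomp Require Import all_boot all_order all_algebra.
From mathcomp Require Import complex reals boolp.
From mathcomp Require Import ring lra zify.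
Set Implicit Arguments.
Unset Strict Implicit.
Unset Printing Implicit Defensive.
Import Order.TTheory GRing.Theory Num.Theory.
Local Open Scope ring_scope.
Local Open Scope complex_scope.

(* Follow the pair (z, w) of an iterate z and its conjugate w over Q(i), which moves by
   (z, w) |-> (1/z - a, 1/w - a), a being the digit of z. Write z = (s - b) / A and
   w = (- s - b) / A with A, b in Z[i] and A dividing b^2 - s^2.
   - The condition [separated], which holds initially because |s| >= 1, is preserved by
     the step. On pairs satisfying it the step is injective: two candidates for the last
     digit would put an iterate on a side of the square X.
   - No iterate lies on a side. If one did, so would its conjugate; pulling the side back
     along the orbit gives a circle through s and - s, and its discriminant forces s onto
     one of the lines u = 0 and v = 0, where the orbit meets the sides only in points
     of Q(i).
   - As |w| >= 1, some e in {1, -1, i, -i} satisfies |z - e| = O(|z - w|). Then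
     A (e - z) (e - w) is a nonzero Gaussian integer, and A (z - w) = 2 s, so that A and b
     are bounded and the orbit is finite.
   A finite orbit of an injective map returns to its starting point. *)

(** * Separation of a point from its conjugate, in coordinates *)

Lemma unit_intP (e f : int) : e * e + f * f = 1 ->
  [\/ e = 1 /\ f = 0, e = -1 /\ f = 0, e = 0 /\ f = 1 | e = 0 /\ f = -1].
Proof.
move=> ef; have [e0|e0] : e = 0 \/ (e = 1 \/ e = -1) by nia.
  have [->|->] : f = 1 \/ f = -1 by nia.
    by constructor 3.
  by constructor 4.
have -> : f = 0 by nia.
by case: e0 => ->; [constructor 1|constructor 2].
Qed.

Lemma unit_dot_lt (R : realFieldType) (e f : int) (x y : R) :
  e * e + f * f = 1 -> -(1/2) < x < 1/2 -> -(1/2) < y < 1/2 ->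
  -(1/2) < e%:~R * x + f%:~R * y < 1/2.
Proof. by move=> /unit_intP[] [-> ->]; rewrite ?mulr1z ?mulr0z ?mulrN1z; lra. Qed.

Lemma unit_intr (R : realFieldType) (e f : int) :
  e * e + f * f = 1 -> e%:~R * e%:~R + f%:~R * f%:~R = 1 :> R.
Proof. by move=> ef; rewrite -!intrM -intrD ef. Qed.

(** By the parallelogram law, [g * g + h * h] is at most twice the sum of the two squared distances,
    hence below 2. *)
Lemma lens_int (R : realFieldType) (P Q : R) (g h : int) :
  P ^+ 2 + Q ^+ 2 < 1/2 -> (P - g%:~R) ^+ 2 + (Q - h%:~R) ^+ 2 < 1/2 ->
  (g = 0 /\ h = 0) \/ g * g + h * h = 1.
Proof.
move=> PQ PQgh.
have : (g * g + h * h)%:~R < 2%:~R :> R.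
  rewrite intrD !intrM; have := sqr_ge0 (2 * P - g%:~R).
  have := sqr_ge0 (2 * Q - h%:~R); nra.
rewrite ltr_int => lt2; have [gh|] : g * g + h * h = 0 \/ g * g + h * h = 1 by nia.
  by left; split; nia.
by right.
Qed.

(* In the coordinates [(u, v)] and [(p, q)] of a point [z] and of its conjugate [w],
   this says [|w| >= 1] and that [z] avoids the disc with diameter [[0, c]] whenever
   [w] lies in the unit disc about [c], for the four smallest nonzero elements
   [c] of [(1 + i) Z[i]]. *)
Definition separated (R : realFieldType) (u v p q : R) : Prop :=
  1/2 <= p ^+ 2 + q ^+ 2 /\
  forall e f : int, e * e + f * f = 1 ->
    (p - e%:~R) ^+ 2 + (q - f%:~R) ^+ 2 < 1/2 ->
    e%:~R * u + f%:~R * v <= u ^+ 2 + v ^+ 2.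

(* The image of [separated] under inversion of both points. *)
Definition inv_separated (R : realFieldType) (U V P Q : R) : Prop :=
  forall e f : int, e * e + f * f = 1 ->
    (P - e%:~R) ^+ 2 + (Q - f%:~R) ^+ 2 < 1/2 -> e%:~R * U + f%:~R * V <= 1/2.

(** The inequalities [e U + f V <= U^2 + V^2] hold for the inverse of any nonzero point of the
    square. With them, [lens_int] leaves only a few digits [(j, l)] to exclude. *)
Lemma separated_shift (R : realFieldType) (U V P Q : R) (j l : int) :
  P ^+ 2 + Q ^+ 2 < 1/2 -> inv_separated U V P Q ->
  1/2 < U ^+ 2 + V ^+ 2 ->
  (forall e f : int, e * e + f * f = 1 ->
     e%:~R * U + f%:~R * V <= U ^+ 2 + V ^+ 2) ->
  -(1/2) < U - j%:~R < 1/2 -> -(1/2) < V - l%:~R < 1/2 ->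
  separated (U - j%:~R) (V - l%:~R) (P - j%:~R) (Q - l%:~R).
Proof.
move=> PQ sep UV outX Uj Vl.
have jl0 : ~ (j = 0 /\ l = 0).
  by move=> [j0 l0]; subst j l; move: Uj Vl; rewrite !mulr0z !subr0; nra.
have dot e f g h : (e%:~R * U + f%:~R * V =
    (e * g + f * h)%:~R + (e%:~R * (U - g%:~R) + f%:~R * (V - h%:~R)) :> R).
  by rewrite intrD !intrM; ring.
split=> [|e f ef lens].
  rewrite leNgt; apply/negP => lens.
  (* A unit digit gives [j U + l V > 1 - 1/2], against [inv_separated]. *)
  have [//|jl] := lens_int PQ lens.
  have := sep _ _ jl lens; have := unit_dot_lt jl Uj Vl.
  by rewrite (dot j l j l) jl; lra.
have lens' : (P - (j + e)%:~R) ^+ 2 + (Q - (l + f)%:~R) ^+ 2 < 1/2.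
  by rewrite !intrD !opprD !addrA.
have [[je lf]|gh] := lens_int PQ lens'.
  (* The digit is [(- e, - f)], and the claim is the hypothesis [outX] at this digit, recentred. *)
  have [-> ->] : j = - e /\ l = - f by clear -je lf; split; lia.
  have ef' : - e * - e + - f * - f = 1 by rewrite !mulrNN.
  have := outX _ _ ef'; have := unit_intr R ef; rewrite !rmorphN !opprK; nra.
exfalso; have := sep _ _ gh lens'; have := unit_dot_lt gh Uj Vl.
(* Here [k] is the product of the unit [(j + e, l + f)] with [(j, l)]. It is at most 0 only if this
   unit equals [(e, f)], that is, if the digit is 0. *)
rewrite (dot _ _ j l); set k := ((_ * j + _)); move=> ? ?.
have : k%:~R < 1%:~R :> R by lra.
rewrite ltr_int /k => kl; apply: jl0; clear -ef gh kl.
by case: (unit_intP gh) kl => -[ge hf]; rewrite ge hf;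
  case: (unit_intP ef) ge hf => -[-> ->]; lia.
Qed.

(** Distinct candidates differ by a unit. The inequalities for this unit and its opposite say that
    its product with [(x, y)] is [1/2 - k] for an integer [k], which would lie strictly between 0
    and 1. *)
Lemma separated_digit (R : realFieldType) (x y p q : R) (j l j' l' : int) :
  -(1/2) < x < 1/2 -> -(1/2) < y < 1/2 ->
  (p + j%:~R) ^+ 2 + (q + l%:~R) ^+ 2 < 1/2 ->
  (p + j'%:~R) ^+ 2 + (q + l'%:~R) ^+ 2 < 1/2 ->
  inv_separated (x + j%:~R) (y + l%:~R) (p + j%:~R) (q + l%:~R) ->
  inv_separated (x + j'%:~R) (y + l'%:~R) (p + j'%:~R) (q + l'%:~R) ->
  j = j' /\ l = l'.
Proof.
move=> xb yb PQ PQ' sep sep'.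
have shift (a : R) (b c : int) : a + c%:~R = a + b%:~R - (b - c)%:~R.
  by rewrite rmorphB /=; ring.
have [[jj ll]|gh] : (j - j' = 0 /\ l - l' = 0) \/
    (j - j') * (j - j') + (l - l') * (l - l') = 1.
- by apply: (lens_int PQ); rewrite -!shift.
- by split; lia.
have hg : (j' - j) * (j' - j) + (l' - l) * (l' - l) = 1 by rewrite -gh; ring.
have := sep _ _ gh; rewrite -!shift => /(_ PQ') le1.
have := sep' _ _ hg; rewrite -!shift => /(_ PQ) le2.
have := unit_dot_lt gh xb yb => lt3.
pose k := (j - j') * j + (l - l') * l.
have kE : k%:~R = (j - j')%:~R * j%:~R + (l - l')%:~R * l%:~R :> R.
  by rewrite -!intrM -intrD.
have kE' : k%:~R - 1 = (j - j')%:~R * j'%:~R + (l - l')%:~R * l'%:~R :> R.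
  have := unit_intr R gh; rewrite kE !rmorphB /=; nra.
have k1 : k%:~R < 1%:~R :> R by nra.
have k0 : 0%:~R < k%:~R :> R.
  have e1 : (j' - j)%:~R = - (j - j')%:~R :> R by rewrite -opprB rmorphN.
  have e2 : (l' - l)%:~R = - (l - l')%:~R :> R by rewrite -opprB rmorphN.
  by move: le2; rewrite e1 e2; nra.
by move: k0 k1; rewrite !ltr_int; clear; lia.
Qed.

(** The origin has power [1 - 1/2] with respect to these circles, so the inversion of power [1/2]
    preserves them. The map [1/z] composes it with the exchange of the two coordinates. *)
Lemma lens_inv (R : realFieldType) (p q : R) (e f : int) :
  0 < p ^+ 2 + q ^+ 2 -> e * e + f * f = 1 ->
  ((q / (2 * (p ^+ 2 + q ^+ 2)) - e%:~R) ^+ 2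
   + (p / (2 * (p ^+ 2 + q ^+ 2)) - f%:~R) ^+ 2 < 1/2)
  = ((p - f%:~R) ^+ 2 + (q - e%:~R) ^+ 2 < 1/2).
Proof.
move=> m0 ef; have := unit_intr R ef.
set E := e%:~R; set F := f%:~R => EF.
have -> : (q / (2 * (p ^+ 2 + q ^+ 2)) - E) ^+ 2
    + (p / (2 * (p ^+ 2 + q ^+ 2)) - F) ^+ 2
    = 1/2 + ((p - F) ^+ 2 + (q - E) ^+ 2 - 1/2) / (2 * (p ^+ 2 + q ^+ 2))
      + (E * E + F * F - 1) * (1 - (2 * (p ^+ 2 + q ^+ 2))^-1).
  by field; rewrite gt_eqF.
rewrite EF subrr mul0r addr0 gtrDl pmulr_llt0 ?subr_lt0 //.
by rewrite invr_gt0 mulr_gt0.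
Qed.

Lemma inv_separatedP (R : realFieldType) (u v p q : R) :
  0 < u ^+ 2 + v ^+ 2 -> 0 < p ^+ 2 + q ^+ 2 ->
  separated u v p q ->
  inv_separated (v / (2 * (u ^+ 2 + v ^+ 2))) (u / (2 * (u ^+ 2 + v ^+ 2)))
                (q / (2 * (p ^+ 2 + q ^+ 2))) (p / (2 * (p ^+ 2 + q ^+ 2))).
Proof.
move=> n0 m0 [_ sep] e f ef; rewrite lens_inv // => lens.
have fe : f * f + e * e = 1 by rewrite addrC.
have := sep _ _ fe lens => le.
have -> : e%:~R * (v / (2 * (u ^+ 2 + v ^+ 2))) + f%:~R * (u / (2 * (u ^+ 2 + v ^+ 2)))
  = (f%:~R * u + e%:~R * v) / (2 * (u ^+ 2 + v ^+ 2)) by field; rewrite gt_eqF.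
by rewrite ler_pdivrMr ?mulr_gt0 //; lra.
Qed.

(** * Gaussian integers and conjugate quadratic numbers *)

Definition gaussian (R : realType) : {pred R[i]} :=
  fun z => (complex.Re z \is a Num.int) && (complex.Im z \is a Num.int).

Lemma gaussian_subring (R : realType) : subring_closed (@gaussian R).
Proof.
split=> [|[a b] [c d] /andP[/= ? ?] /andP[/= ? ?]|
  [a b] [c d] /andP[/= ? ?] /andP[/= ? ?]].
- by apply/andP; split=> /=; rewrite ?rpred1 ?rpred0.
- by apply/andP; split=> /=; rewrite rpredB.
- by apply/andP; split=> /=; rewrite ?rpredB ?rpredD ?rpredM.
Qed.

HB.instance Definition _ (R : realType) :=
  GRing.isSubringClosed.Build R[i] (@gaussian R) (@gaussian_subring R).

Ltac gauss := by do ?[by [] | exact: rpred_nat | apply: rpredB | apply: rpredD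
  | apply: rpredM | apply: rpredX].

Lemma gaussian_intP (R : realType) (z : R[i]) :
  z \in @gaussian R -> exists p q : int, z = p%:~R +i* q%:~R.
Proof. by case: z => a b /andP[/= /intrP[p ->] /intrP[q ->]]; exists p, q. Qed.

Lemma gaussian_conj (R : realType) (z : R[i]) :
  z \in @gaussian R -> conjc z \in @gaussian R.
Proof. by case: z => a b /andP[/= ? ?]; apply/andP; rewrite /= rpredN. Qed.

Lemma gaussian_i (R : realType) : 'i \in @gaussian R.
Proof. by apply/andP; split=> /=; rewrite ?rpred0 ?rpred1. Qed.

Lemma gaussian_lin_eq0 (R : realType) (s A B : R[i]) : ~ in_Qi s ->
  A \in @gaussian R -> B \in @gaussian R -> A * s = B -> A = 0.
Proof.
move=> irr /gaussian_intP[a [a' ->]] /gaussian_intP[b [b' ->]] AsB.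
apply/eqP/negPn/negP => A0; apply: irr.
have N0 : (a%:~R * a%:~R + a'%:~R * a'%:~R : R) != 0.
  by rewrite -!expr2 paddr_eq0 ?sqr_ge0 // !sqrf_eq0; move: A0; rewrite eq_complex.
(* The coordinates of [B * conjc A] divided by the squared modulus of [A]. *)
exists ((b * a + b' * a')%:~R / (a * a + a' * a')%:~R),
  ((b' * a - b * a')%:~R / (a * a + a' * a')%:~R).
rewrite !fmorph_div /= !ratr_int !intrD rmorphN /= !intrM.
have := AsB; case: s {AsB} => x y /eqP; rewrite eq_complex /= => /andP[/eqP <- /eqP <-].
by apply/eqP; rewrite eq_complex /=; apply/andP; split; apply/eqP; field.
Qed.

(* Half of the squared modulus. *)
Definition nT (R : realType) (z : R[i]) : R := uT z ^+ 2 + vT z ^+ 2.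

Lemma mul_conj_nT (R : realType) (z : R[i]) : z * conjc z = (2 * nT z)%:C.
Proof.
by case: z => a b; apply/eqP; rewrite eq_complex /nT /uT /vT /=; apply/andP; split;
  apply/eqP; field.
Qed.

Lemma nTM (R : realType) (z w : R[i]) : nT (z * w) = 2 * nT z * nT w.
Proof. by case: z w => [a b] [c d]; rewrite /nT /uT /vT /=; field. Qed.

Lemma nT_eq0 (R : realType) (z : R[i]) : (nT z == 0) = (z == 0).
Proof.
case: z => a b; rewrite eq_complex /nT /uT /vT /= paddr_eq0 ?sqr_ge0 // !sqrf_eq0.
by apply/andP/andP => -[/eqP ? /eqP ?]; split; apply/eqP; lra.
Qed.

Lemma nT_gt0 (R : realType) (z : R[i]) : z != 0 -> 0 < nT z.
Proof. by move=> z0; rewrite lt_def nT_eq0 z0 addr_ge0 ?sqr_ge0. Qed.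

Lemma uTB (R : realType) (z w : R[i]) : uT (z - w) = uT z - uT w.
Proof. by case: z w => [a b] [c d]; rewrite /uT /=; field. Qed.

Lemma vTB (R : realType) (z w : R[i]) : vT (z - w) = vT z - vT w.
Proof. by case: z w => [a b] [c d]; rewrite /vT /=; field. Qed.

Lemma uTN (R : realType) (z : R[i]) : uT (- z) = - uT z.
Proof. by case: z => [a b]; rewrite /uT /=; field. Qed.

Lemma vTN (R : realType) (z : R[i]) : vT (- z) = - vT z.
Proof. by case: z => [a b]; rewrite /vT /=; field. Qed.

Lemma coordT_inj (R : realType) (z w : R[i]) : uT z = uT w -> vT z = vT w -> z = w.
Proof.
case: z w => [a b] [c d]; rewrite /uT /vT /= => u v.
by apply/eqP; rewrite eq_complex /=; apply/andP; split; apply/eqP; lra.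
Qed.

Lemma uTV (R : realType) (z : R[i]) : z != 0 -> uT z^-1 = vT z / (2 * nT z).
Proof.
move=> /nT_gt0; case: z => a b; rewrite /nT /uT /vT /= => n0.
have n1 : a ^+ 2 + b ^+ 2 != 0 by rewrite gt_eqF //; lra.
field; rewrite n1 andbT (_ : _ + _ = 2 * (a ^+ 2 + b ^+ 2)); last by ring.
by rewrite mulf_neq0 ?pnatr_eq0.
Qed.

Lemma vTV (R : realType) (z : R[i]) : z != 0 -> vT z^-1 = uT z / (2 * nT z).
Proof.
move=> /nT_gt0; case: z => a b; rewrite /nT /uT /vT /= => n0.
have n1 : a ^+ 2 + b ^+ 2 != 0 by rewrite gt_eqF //; lra.
field; rewrite n1 andbT (_ : _ + _ = 2 * (a ^+ 2 + b ^+ 2)); last by ring.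
by rewrite mulf_neq0 ?pnatr_eq0.
Qed.

Lemma nTV (R : realType) (z : R[i]) : z != 0 -> nT z^-1 = (4 * nT z)^-1.
Proof.
move=> z0; have n0 := nT_gt0 z0; rewrite {1}/nT uTV // vTV //.
have : nT z = uT z ^+ 2 + vT z ^+ 2 by [].
move: (nT z) (uT z) (vT z) n0 => n u v n0 nE.
rewrite !expr_div_n -mulrDl addrC -nE.
by field; rewrite gt_eqF.
Qed.

Lemma coordT_floorT (R : realType) (z : R[i]) :
  uT (floorT z) = (Num.floor (uT z + 1/2))%:~R /\
  vT (floorT z) = (Num.floor (vT z + 1/2))%:~R.
Proof.
have [] := (coordTE (floorT z) (Num.floor (uT z + 1/2))%:~R
  (Num.floor (vT z + 1/2))%:~R).1 => [|-> ->//].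
by rewrite !(rmorph_int (real_complex R)).
Qed.

Lemma gaussian_floorT (R : realType) (z : R[i]) : floorT z \in @gaussian R.
Proof.
have i := gaussian_i R.
apply: rpredD; apply: rpredM; rewrite ?rpred_int //.
  by apply: rpredD; rewrite ?rpred1.
by apply: rpredB; rewrite ?rpred1.
Qed.

(* [z] and [w] are [(s - b) / A] and [(- s - b) / A], the roots of [A x^2 + 2 b x + C],
   which has Gaussian coefficients and reduced discriminant [s^2]. *)
Definition conj_roots (R : realType) (s z w A b C : R[i]) : Prop :=
  [/\ [/\ A \in @gaussian R, b \in @gaussian R & C \in @gaussian R],
      A * C = b ^+ 2 - s ^+ 2, A * z = s - b & A * w = - s - b].

Lemma conj_roots_shift (R : realType) (s z w A b C a : R[i]) :
  a \in @gaussian R -> conj_roots s z w A b C ->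
  conj_roots s (z - a) (w - a) A (A * a + b) (A * a ^+ 2 + 2%:R * b * a + C).
Proof.
move=> ga [[gA gb gC] AC Az Aw]; split; first split.
- by [].
- by rewrite rpredD ?rpredM.
- by rewrite !rpredD ?rpredM ?rpredX ?rpred_nat.
- by ring: AC.
- by ring: Az.
- by ring: Aw.
Qed.

(** The reciprocal polynomial, negated so that [z^-1] is still the root with [+ s]. *)
Lemma conj_roots_inv (R : realType) (s z w A b C : R[i]) :
  A != 0 -> z != 0 -> w != 0 -> conj_roots s z w A b C ->
  conj_roots s z^-1 w^-1 (- C) (- b) (- A).
Proof.
move=> A0 z0 w0 [[gA gb gC] AC Az Aw]; split; rewrite ?rpredN //.
- by rewrite mulrNN sqrrN -AC mulrC.
- apply: (mulfI A0); apply: (mulIf z0).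
  by rewrite mulrA mulfVK // [RHS]mulrAC Az mulrN AC; ring.
- apply: (mulfI A0); apply: (mulIf w0).
  by rewrite mulrA mulfVK // [RHS]mulrAC Aw mulrN AC; ring.
Qed.

Lemma conj_roots_neq0 (R : realType) (s z w A b C : R[i]) : ~ in_Qi s ->
  conj_roots s z w A b C -> [/\ A != 0, C != 0, z != 0 & w != 0].
Proof.
move=> irr [[gA gb gC] AC Az Aw].
have sb (t : R[i]) : t \in @gaussian R -> s - t != 0.
  move=> gt; apply/eqP => /eqP; rewrite subr_eq0 => /eqP st.
  have := gaussian_lin_eq0 irr (rpred1 _) gt; rewrite mul1r => /(_ st) /eqP.
  by rewrite oner_eq0.
have AC0 : A * C != 0.
  rewrite AC -oppr_eq0 opprB subr_sqr mulf_neq0 ?sb //.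
  by rewrite -[b]opprK sb ?rpredN.
split; apply: contra_neq AC0 => e0.
- by rewrite e0 mul0r.
- by rewrite e0 mulr0.
- by move: Az (sb _ gb); rewrite e0 mulr0 => <-; rewrite eqxx.
- move: Aw (sb (- b)); rewrite e0 mulr0 rpredN gb opprK => /esym/eqP.
  by rewrite -opprD oppr_eq0 => /eqP-> /(_ isT); rewrite eqxx.
Qed.

Lemma conj_roots_sym (R : realType) (s z w A b C : R[i]) :
  conj_roots s z w A b C -> conj_roots (- s) w z A b C.
Proof. by case=> gABC AC Az Aw; split; rewrite ?sqrrN ?opprK. Qed.

Lemma in_QiN (R : realType) (s : R[i]) : in_Qi (- s) -> in_Qi s.
Proof.
move=> [p [q spq]]; exists (- p), (- q).
by rewrite -[s]opprK spq !rmorphN.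
Qed.

Lemma conj_roots_poly (R : realType) (s z w A b C : R[i]) :
  A != 0 -> conj_roots s z w A b C -> A * z ^+ 2 + 2%:R * b * z + C = 0.
Proof.
move=> A0 [_ AC Az _]; apply: (mulfI A0); rewrite mulr0.
transitivity ((A * z) ^+ 2 + 2%:R * b * (A * z) + A * C); first by ring.
by rewrite AC Az; ring.
Qed.

Lemma conj_poly (R : realType) (A b C z : R[i]) :
  A * z ^+ 2 + 2%:R * b * z + C = 0 ->
  conjc A * (conjc z) ^+ 2 + 2%:R * conjc b * conjc z + conjc C = 0.
Proof.
move=> /(congr1 (@conjc R)); rewrite conjc0 => <-.
by rewrite !expr2 !rmorphD !rmorphM rmorph_nat.
Qed.

(* Substituting [c * conjc z = - 2 - conjc c * z] in the conjugate of the equation of [z]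
   gives a second Gaussian equation for [z], which must be proportional to the first. *)
Lemma conj_roots_line (R : realType) (s z w A b C c : R[i]) : ~ in_Qi s ->
  conj_roots s z w A b C -> c \in @gaussian R -> c * conjc c = 2%:R ->
  conjc c * z + c * conjc z = - 2%:R -> conjc c * w + c * conjc w = - 2%:R.
Proof.
move=> irr zw gc cc line.
have [A0 _ _ _] := conj_roots_neq0 irr zw.
have qz := conj_roots_poly A0 zw; have qzc := conj_poly qz.
have [[gA gb gC] AC Az Aw] := zw.
have [gA' gb' gC' gc'] := And4 (gaussian_conj gA) (gaussian_conj gb)
  (gaussian_conj gC) (gaussian_conj gc).
have Ac0 : conjc A != 0 by rewrite conjc_eq0.
have c0 : conjc c != 0.
  by apply/eqP => c0; move/eqP: cc; rewrite c0 mulr0 eq_sym pnatr_eq0.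
have Awc : conjc A * conjc w = - 2%:R * conjc b - conjc A * conjc z.
  have -> : conjc A * conjc w = conjc (A * w) by rewrite rmorphM.
  have -> : A * w = - 2%:R * b - A * z by rewrite Az Aw; ring.
  by rewrite rmorphB !rmorphM rmorphN rmorph_nat.
have {}Aw : A * w = - 2%:R * b - A * z by rewrite Az Aw; ring.
move: gA' gb' gC' gc' Ac0 c0 Awc qzc line cc.
move: (conjc A) (conjc b) (conjc C) (conjc c) (conjc z) (conjc w) => A' b' C' c' z' w'.
move=> gA' gb' gC' gc' A'0 c'0 Awc qzc line cc.
(* Coefficients of [A * c ^+ 2] times the conjugate equation minus [A' * c' ^+ 2] times the original
   one, after the substitution: the terms in [z ^+ 2] cancel. *)
pose K := A * (4%:R * A' * c' - 4%:R * b') - 2%:R * b * A' * c' ^+ 2.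
pose L := A * (4%:R * A' - 4%:R * b' * c + C' * c ^+ 2) - A' * c' ^+ 2 * C.
have gK : K \in @gaussian R by gauss.
have gL : L \in @gaussian R by gauss.
have cz' : c * z' = - 2%:R - c' * z by rewrite -line; ring.
have KL : K * z + L = 0.
  transitivity (A * c ^+ 2 * (A' * z' ^+ 2 + 2%:R * b' * z' + C')
    - A' * c' ^+ 2 * (A * z ^+ 2 + 2%:R * b * z + C)); last first.
    by rewrite qz qzc !mulr0 subr0.
  rewrite /K /L (_ : A * c ^+ 2 * _ =
    A * (A' * (c * z') ^+ 2 + 2%:R * b' * c * (c * z') + C' * c ^+ 2)); last by ring.
  by rewrite cz'; ring: cc.
have K0 : K = 0.
  apply: (gaussian_lin_eq0 (B := K * b - L * A) irr gK); first by gauss.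
  have -> : s = A * z + b by rewrite Az; ring.
  transitivity (A * (K * z + L) + K * b - L * A); first by ring.
  by rewrite KL mulr0 add0r.
apply/eqP; rewrite -addr_eq0; apply/eqP.
(* Since [z + w = - 2 b / A], [K] is [A * A' * c'] times the expression that has to vanish. *)
apply: (mulfI (mulf_neq0 (mulf_neq0 A0 A'0) c'0)); rewrite mulr0 -K0 /K.
transitivity (c' * (c' * A' * (A * w) + c * A * (A' * w') + 2%:R * A * A')); first by ring.
rewrite Aw Awc.
transitivity (- 2%:R * b * A' * c' ^+ 2 - 2%:R * b' * A * (c * c')
  - A * A' * c' * (c' * z + c * z') + 2%:R * A * A' * c'); first by ring.
by rewrite cc line; ring.
Qed.

(* The conjugate of the equation of [w], with [conjc w = w^-1], is proportional to that
   equation, so that [|A| = |C|]. *)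
Lemma conj_roots_circle (R : realType) (s z w A b C : R[i]) : ~ in_Qi s ->
  conj_roots s z w A b C -> nT w = 1/2 -> nT z = 1/2.
Proof.
move=> irr zw nw.
have irrN : ~ in_Qi (- s) by move/in_QiN.
have [A0 _ _ _] := conj_roots_neq0 irr zw.
have qw := conj_roots_poly A0 (conj_roots_sym zw); have qwc := conj_poly qw.
have [[gA gb gC] AC Az Aw] := zw.
have ww : w * conjc w = 1 by rewrite mul_conj_nT nw mul1r divff ?pnatr_eq0.
pose K := 2%:R * (b * conjc C - conjc b * A).
pose L := C * conjc C - A * conjc A.
have [gA' gb' gC'] := And3 (gaussian_conj gA) (gaussian_conj gb) (gaussian_conj gC).
have gK : K \in @gaussian R by gauss.
have gL : L \in @gaussian R by gauss.
have KL : K * w + L = 0.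
  transitivity (conjc C * (A * w ^+ 2 + 2%:R * b * w + C)
    - A * w ^+ 2 * (conjc A * (conjc w) ^+ 2 + 2%:R * conjc b * conjc w + conjc C));
    last first.
    by rewrite qw qwc !mulr0 subr0.
  by rewrite /K /L; move: (conjc w) ww => w' ww; ring: ww.
have K0 : K = 0.
  apply: (gaussian_lin_eq0 (B := K * b - L * A) irrN gK); first by gauss.
  have -> : - s = A * w + b by rewrite Aw; ring.
  transitivity (A * (K * w + L) + K * b - L * A); first by ring.
  by rewrite KL mulr0 add0r.
have : nT C = nT A.
  move: KL; rewrite K0 mul0r add0r /L => /eqP.
  rewrite subr_eq0 !mul_conj_nT => /eqP /complexI; lra.
have -> : C = A * (z * w).
  apply: (mulfI A0); rewrite AC.
  transitivity ((A * z) * (A * w)); last by ring.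
  by rewrite Az Aw; ring.
rewrite !nTM nw => e; have := nT_gt0 A0; nra.
Qed.

(** This is [conj_roots_line] for [c = 1 + 'i]; the other side of the square takes [c = 1 - 'i]. *)
Lemma conj_roots_uT (R : realType) (s z w A b C : R[i]) : ~ in_Qi s ->
  conj_roots s z w A b C -> uT z = -(1/2) -> uT w = -(1/2).
Proof.
move=> irr zw uz.
have E (t : R[i]) : conjc (1 + 'i) * t + (1 + 'i) * conjc t = (4 * uT t)%:C.
  by case: t => x y; apply/eqP; rewrite eq_complex /uT /=; apply/andP; split;
    apply/eqP; field.
have gc : 1 + 'i \in @gaussian R by rewrite rpredD ?rpred1 ?gaussian_i.
have cc : (1 + 'i) * conjc (1 + 'i) = 2%:R :> R[i].
  by apply/eqP; rewrite eq_complex /=; apply/andP; split; apply/eqP; ring.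
have N2 : - 2%:R = (-2)%:C :> R[i] by rewrite rmorphN /= rmorph_nat.
have := conj_roots_line irr zw gc cc.
rewrite !E N2 => H; have e : 4 * uT z = -2 by lra.
by have /complexI := H (congr1 _ e); lra.
Qed.

Lemma conj_roots_vT (R : realType) (s z w A b C : R[i]) : ~ in_Qi s ->
  conj_roots s z w A b C -> vT z = -(1/2) -> vT w = -(1/2).
Proof.
move=> irr zw uz.
have E (t : R[i]) : conjc (1 - 'i) * t + (1 - 'i) * conjc t = (4 * vT t)%:C.
  by case: t => x y; apply/eqP; rewrite eq_complex /vT /=; apply/andP; split;
    apply/eqP; field.
have gc : 1 - 'i \in @gaussian R by rewrite rpredB ?rpred1 ?gaussian_i.
have cc : (1 - 'i) * conjc (1 - 'i) = 2%:R :> R[i].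
  by apply/eqP; rewrite eq_complex /=; apply/andP; split; apply/eqP; ring.
have N2 : - 2%:R = (-2)%:C :> R[i] by rewrite rmorphN /= rmorph_nat.
have := conj_roots_line irr zw gc cc.
rewrite !E N2 => H; have e : 4 * vT z = -2 by lra.
by have /complexI := H (congr1 _ e); lra.
Qed.

(** * Orbits avoid the sides of the square *)

(** With the factor 2 on [nT], inversion exchanges [A] with [C] and [p] with [q]. *)
Definition circle_eq (R : realType) (A p q C : int) (z : R[i]) : Prop :=
  2 * A%:~R * nT z + 2 * p%:~R * uT z + 2 * q%:~R * vT z + C%:~R = 0.

(* Inversions and translations by [(1 + i) Z[i]] map the sides of [domX] to circles or
   lines with such an equation of discriminant 1. *)
Definition on_side_orbit (R : realType) (z w : R[i]) : Prop :=
  exists A p q C : int, [/\ p * p + q * q - 2 * A * C = 1,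
    circle_eq A p q C z & circle_eq A p q C w].

Lemma on_side_orbit_shift (R : realType) (z w : R[i]) (a : R[i]) :
  on_side_orbit (z - floorT a) (w - floorT a) -> on_side_orbit z w.
Proof.
have [fu fv] := coordT_floorT a.
move=> [A [p [q [C [pq]]]]]; rewrite /circle_eq /nT !uTB !vTB fu fv.
set j := Num.floor _; set l := Num.floor _ => cz cw.
exists A, (p - 2 * A * j), (q - 2 * A * l),
  (C + 2 * A * (j * j + l * l) - 2 * p * j - 2 * q * l); split.
- by rewrite -[RHS]pq; ring.
- by rewrite /circle_eq -[RHS]cz /nT !(rmorphB, rmorphD, rmorphM); ring.
- by rewrite /circle_eq -[RHS]cw /nT !(rmorphB, rmorphD, rmorphM); ring.
Qed.

Lemma on_side_orbit_inv (R : realType) (z w : R[i]) :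
  z != 0 -> w != 0 -> on_side_orbit z^-1 w^-1 -> on_side_orbit z w.
Proof.
move=> z0 w0 [A [p [q [C [pq cz cw]]]]]; exists C, q, p, A; split.
- by rewrite -[RHS]pq; ring.
- move: cz; rewrite /circle_eq nTV // uTV // vTV //; have := nT_gt0 z0.
  move: (nT z) => n n0 /(congr1 ( *%R (2 * n))); rewrite mulr0 => <-.
  by field; rewrite gt_eqF.
- move: cw; rewrite /circle_eq nTV // uTV // vTV //; have := nT_gt0 w0.
  move: (nT w) => n n0 /(congr1 ( *%R (2 * n))); rewrite mulr0 => <-.
  by field; rewrite gt_eqF.
Qed.

(* [x.2] is to be the conjugate of [x.1], so it moves with the digit of [x.1]. *)
Definition TT_pair (R : realType) (x : R[i] * R[i]) : R[i] * R[i] :=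
  (TT x.1, x.2^-1 - floorT x.1^-1).

Lemma TT_neq0 (R : realType) (z : R[i]) : z != 0 -> TT z = z^-1 - floorT z^-1.
Proof. by rewrite /TT => /negPf ->. Qed.

Definition are_conj (R : realType) (s : R[i]) (x : R[i] * R[i]) : Prop :=
  exists A b C, conj_roots s x.1 x.2 A b C.

Lemma are_conj_neq0 (R : realType) (s : R[i]) (x : R[i] * R[i]) : ~ in_Qi s ->
  are_conj s x -> x.1 != 0 /\ x.2 != 0.
Proof. by move=> irr [A [b [C /(conj_roots_neq0 irr)[]]]]. Qed.

Lemma are_conj_TT (R : realType) (s : R[i]) (x : R[i] * R[i]) : ~ in_Qi s ->
  are_conj s x -> are_conj s (TT_pair x).
Proof.
move=> irr [A [b [C zw]]].
have [A0 C0 z0 w0] := conj_roots_neq0 irr zw.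
have := conj_roots_shift (gaussian_floorT x.1^-1) (conj_roots_inv A0 z0 w0 zw).
by rewrite -TT_neq0 // => zw'; do 3 eexists; exact: zw'.
Qed.

(** Inversion exchanges the two axes, and a coordinate 0 has digit 0. *)
Lemma uT_mul_vT_TT (R : realType) (z : R[i]) :
  uT z * vT z = 0 -> uT (TT z) * vT (TT z) = 0.
Proof.
have [->|z0] := eqVneq z 0; first by rewrite /TT eqxx.
have fl : Num.floor (1/2 : R) = 0 by apply: floor_def; lra.
move=> /eqP; rewrite mulf_eq0 TT_neq0 // uTB vTB.
have [-> ->] := coordT_floorT z^-1; rewrite uTV // vTV //.
by move=> /orP[/eqP ->|/eqP ->]; rewrite !mul0r !add0r fl mulr0z oppr0 ?mulr0 ?mul0r.
Qed.

(** The fourth power of the modulus of [s] is the positive integer [m * m + n * n]. *)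
Lemma nT_sqrt_ge (R : realType) (m n : int) (s : R[i]) :
  s ^+ 2 = m%:~R +i* n%:~R -> ~ in_Qi s -> 1/2 <= nT s.
Proof.
move=> s2 irr; have s0 : s != 0.
  apply/eqP => s0; apply: irr; exists 0, 0; rewrite s0.
  by apply/eqP; rewrite eq_complex /= !rmorph0 eqxx.
have : 2 * nT s * nT s = (m * m + n * n)%:~R / 2.
  by rewrite -nTM -expr2 s2 /nT /uT /vT /= intrD !intrM; field.
have n0 := nT_gt0 s0 => e.
have : 0%:~R < (m * m + n * n)%:~R :> R.
  suff : 0 < (m * m + n * n)%:~R / 2 :> R by lra.
  by rewrite -e; nra.
rewrite ltr_int gtz0_ge1 -(ler_int R) mulr1z; nra.
Qed.

(** Adding and subtracting the two equations gives [C = - 2 A nT s] and [p u + q v = 0]. The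
    discriminant becomes [p^2 + q^2 + 4 A^2 nT s = 1], which forces [A = 0] and makes [(p, q)] a
    unit. *)
Lemma side_sqrt (R : realType) (s : R[i]) : 1/2 <= nT s ->
  on_side_orbit s (- s) -> uT s * vT s = 0.
Proof.
move=> n1 [A [p [q [C [pq]]]]]; rewrite /circle_eq /nT !uTN !vTN !sqrrN -/(nT s).
move=> cz cw.
have pquv : p%:~R * uT s + q%:~R * vT s = 0 by lra.
have AC : C%:~R = - 2 * A%:~R * nT s by lra.
have pqR : p%:~R * p%:~R + q%:~R * q%:~R - 2 * A%:~R * C%:~R = 1 :> R.
  by rewrite -[RHS](congr1 intr pq) !(rmorphB, rmorphD, rmorphM).
have A0 : A = 0.
  have : (2 * (A * A))%:~R <= 1%:~R :> R.
    rewrite !intrM; move: pqR; rewrite AC; nra.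
  by rewrite ler_int; clear; nia.
move: pq; rewrite A0 mulr0 mul0r subr0 => /unit_intP.
by case=> -[pE qE]; move: pquv; rewrite pE qE => e; apply/eqP;
  rewrite mulf_eq0; apply/orP; [left|left|right|right]; apply/eqP; lra.
Qed.

Lemma side_orbit (R : realType) (s : R[i]) (x : R[i] * R[i]) : ~ in_Qi s ->
  are_conj s x -> uT x.1 = -(1/2) \/ vT x.1 = -(1/2) -> on_side_orbit x.1 x.2.
Proof.
move=> irr [A [b [C zw]]] [u|v].
  exists 0, 1, 0, 1; rewrite /circle_eq u (conj_roots_uT irr zw u).
  by split=> //; rewrite mulr1z mulr0z; lra.
exists 0, 0, 1, 1; rewrite /circle_eq v (conj_roots_vT irr zw v).
by split=> //; rewrite mulr1z mulr0z; lra.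
Qed.

Lemma conj_not_Qi (R : realType) (s : R[i]) (x : R[i] * R[i]) (p q : rat) :
  ~ in_Qi s -> are_conj s x -> uT x.1 = ratr p -> vT x.1 = ratr q -> False.
Proof.
move=> irr [A [b [C [[gA gb _] _ Az _]]]].
have sE : s = A * x.1 + b by rewrite Az subrK.
move: sE; case: x {Az} => -[c d] w;  rewrite /uT /vT /= => sE up vq.
have cE : c = ratr (p + q) by rewrite rmorphD /= -up -vq; field.
have dE : d = ratr (p - q) by rewrite rmorphB /= -up -vq; field.
have [a [a' AE]] := gaussian_intP gA; have [e [e' bE]] := gaussian_intP gb.
apply: irr; exists (a%:~R * (p + q) - a'%:~R * (p - q) + e%:~R),
  (a%:~R * (p - q) + a'%:~R * (p + q) + e'%:~R).
rewrite sE AE bE cE dE !rmorphD !rmorphM !rmorphN /= !rmorphD !rmorphN /= !ratr_int.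
by apply/eqP; rewrite eq_complex /=; apply/andP; split; apply/eqP; ring.
Qed.

Lemma TT_pair_interior (R : realType) (m n : int) (s : R[i]) (k : nat) :
  s ^+ 2 = m%:~R +i* n%:~R -> ~ in_Qi s ->
  let x := iter k (@TT_pair R) (s - floorT s, - s - floorT s) in
  [/\ are_conj s x, -(1/2) < uT x.1 < 1/2 & -(1/2) < vT x.1 < 1/2].
Proof.
move=> s2 irr; set x0 := (_, _) => /=; set x := fun k => iter k (@TT_pair R) x0.
have cj j : are_conj s (x j).
  elim: j => [|j IH]; last exact: are_conj_TT.
  have s2g : s ^+ 2 \in @gaussian R by rewrite s2; apply/andP; split; apply: rpred_int.
  exists 1, (floorT s), (floorT s ^+ 2 - s ^+ 2); split=> /=; rewrite ?mul1r //.
  split; [exact: rpred1|exact: gaussian_floorT|].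
  by apply: rpredB => //; apply: rpredX; exact: gaussian_floorT.
have dX j : domX (x j).1 by case: j => [|j]; [exact: floorT_domX|exact: TT_domX].
have back j : on_side_orbit (x j).1 (x j).2 -> on_side_orbit s (- s).
  elim: j => [|j IH]; first exact: on_side_orbit_shift.
  have [z0 w0] := are_conj_neq0 irr (cj j).
  rewrite /= TT_neq0 // => /on_side_orbit_shift /(on_side_orbit_inv z0 w0); exact: IH.
have axis j : uT s * vT s = 0 -> uT (x j).1 * vT (x j).1 = 0.
  elim: j => [|j IH] uv; last by apply: uT_mul_vT_TT; exact: IH.
  have fl : Num.floor (1/2 : R) = 0 by apply: floor_def; lra.
  rewrite /= uTB vTB; have [-> ->] := coordT_floorT s.
  by move/eqP: uv; rewrite mulf_eq0 => /orP[/eqP ->|/eqP ->];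
    rewrite !add0r fl mulr0z oppr0 ?mul0r ?mulr0.
(* Of its four sides, [domX] contains points only of the lower ones, up to the excluded corners. *)
have [//|side] : (-(1/2) < uT (x k).1 < 1/2 /\ -(1/2) < vT (x k).1 < 1/2) \/
  (uT (x k).1 = -(1/2) \/ vT (x k).1 = -(1/2)).
- have := dX k; rewrite /domX => /andP[/andP[u1 u2] /andP[v1 v2]].
  have [|un] := eqVneq (uT (x k).1) (-(1/2)); first by right; left.
  have [|vn] := eqVneq (vT (x k).1) (-(1/2)); first by right; right.
  by left; rewrite u2 v2 !lt_def un vn u1 v1.
- by case=> u v; split=> //; exact: cj.
exfalso; have h : -(1/2) = ratr (-(1/2)) :> R.
  by rewrite rmorphN fmorph_div rmorph1 rmorph_nat.
(* Now [s] lies on an axis, hence so does the iterate: one of its coordinates is [-(1/2)] and the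
   other is 0, both rational. *)
have := axis k (side_sqrt (nT_sqrt_ge s2 irr) (back k (side_orbit irr (cj k) side))).
case: side => e; rewrite e => /eqP; rewrite mulf_eq0 => /orP[] /eqP e0.
- by clear -e0; lra.
- by apply: (conj_not_Qi irr (cj k) (p := -(1/2)) (q := 0)); rewrite ?rmorph0 -?h.
- by apply: (conj_not_Qi irr (cj k) (p := 0) (q := -(1/2))); rewrite ?rmorph0 -?h.
- by clear -e0; lra.
Qed.

(** * Injectivity of the step *)

Definition interiorX (R : realType) (z : R[i]) : Prop :=
  -(1/2) < uT z < 1/2 /\ -(1/2) < vT z < 1/2.

Definition conj_separated (R : realType) (x : R[i] * R[i]) : Prop :=
  separated (uT x.1) (vT x.1) (uT x.2) (vT x.2).

Lemma interiorX_nT (R : realType) (z : R[i]) : interiorX z -> nT z < 1/2.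
Proof. by rewrite /nT => -[]; nra. Qed.

Lemma conj_separated_inv (R : realType) (s : R[i]) (x : R[i] * R[i]) :
  ~ in_Qi s -> are_conj s x -> interiorX x.1 -> conj_separated x ->
  nT x.2^-1 < 1/2 /\
  inv_separated (uT x.1^-1) (vT x.1^-1) (uT x.2^-1) (vT x.2^-1).
Proof.
move=> irr cj /interiorX_nT zX sep; have [z0 w0] := are_conj_neq0 irr cj.
have n0 := nT_gt0 z0; have m0 := nT_gt0 w0.
(* Strict, since a conjugate on the unit circle would put [x.1] there too, outside the interior of
   the square. *)
have m1 : 1/2 < nT x.2.
  rewrite lt_neqAle sep.1 andbT eq_sym; apply/eqP => w1.
  have [A [b [C zw]]] := cj; have := conj_roots_circle irr zw w1; lra.
split; last by rewrite !uTV // !vTV //; apply: inv_separatedP.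
by rewrite nTV // invf_plt ?posrE ?mulr_gt0 //; lra.
Qed.

Lemma conj_separated_TT (R : realType) (s : R[i]) (x : R[i] * R[i]) :
  ~ in_Qi s -> are_conj s x -> interiorX x.1 -> interiorX (TT x.1) ->
  conj_separated x -> conj_separated (TT_pair x).
Proof.
move=> irr cj zX z1X sep; have [z0 w0] := are_conj_neq0 irr cj.
have [W1 invsep] := conj_separated_inv irr cj zX sep.
have [zu zv] := zX; have := nT_gt0 z0; have := interiorX_nT zX => n1 n0.
move: z1X; rewrite /conj_separated /interiorX /= TT_neq0 // !uTB !vTB.
have [-> ->] := coordT_floorT x.1^-1 => -[z1u z1v].
apply: separated_shift => //.
  by rewrite -/(nT _) nTV // invf_pgt ?posrE ?mulr_gt0 //; lra.
move=> e f ef; rewrite -/(nT _) nTV // uTV // vTV //.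
have fe : f * f + e * e = 1 by rewrite addrC.
have := unit_dot_lt fe zu zv => dot.
have -> : e%:~R * (vT x.1 / (2 * nT x.1)) + f%:~R * (uT x.1 / (2 * nT x.1))
   = 2 * (f%:~R * uT x.1 + e%:~R * vT x.1) / (4 * nT x.1) by field; rewrite gt_eqF.
by rewrite ler_pdivrMr ?mulr_gt0 // mulVf ?gt_eqF ?mulr_gt0 //; lra.
Qed.

(** Both inverses are the common image plus a digit, and [separated_digit] shows that the digits
    agree. *)
Lemma TT_pair_inj (R : realType) (s : R[i]) (x y : R[i] * R[i]) :
  ~ in_Qi s -> are_conj s x -> are_conj s y -> interiorX x.1 -> interiorX y.1 ->
  interiorX (TT x.1) -> conj_separated x -> conj_separated y ->
  TT_pair x = TT_pair y -> x = y.
Proof.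
move=> irr cjx cjy xX yX [u1 v1] sx sy [e1 e2].
have [x0 x0'] := are_conj_neq0 irr cjx; have [y0 y0'] := are_conj_neq0 irr cjy.
have [Wx ix] := conj_separated_inv irr cjx xX sx.
have [Wy iy] := conj_separated_inv irr cjy yX sy.
have [fxu fxv] := coordT_floorT x.1^-1; have [fyu fyv] := coordT_floorT y.1^-1.
have xE : x.1^-1 = TT x.1 + floorT x.1^-1 by rewrite TT_neq0 // subrK.
have yE : y.1^-1 = TT x.1 + floorT y.1^-1 by rewrite e1 TT_neq0 // subrK.
have xE' : x.2^-1 = (x.2^-1 - floorT x.1^-1) + floorT x.1^-1 by rewrite subrK.
have yE' : y.2^-1 = (x.2^-1 - floorT x.1^-1) + floorT y.1^-1 by rewrite e2 subrK.
have uTD (a b : R[i]) : uT (a + b) = uT a + uT b by rewrite -[b in LHS]opprK uTB uTN opprK.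
have vTD (a b : R[i]) : vT (a + b) = vT a + vT b by rewrite -[b in LHS]opprK vTB vTN opprK.
have [j l] : Num.floor (uT x.1^-1 + 1/2) = Num.floor (uT y.1^-1 + 1/2) /\
    Num.floor (vT x.1^-1 + 1/2) = Num.floor (vT y.1^-1 + 1/2).
  apply: (separated_digit (p := uT (x.2^-1 - floorT x.1^-1))
    (q := vT (x.2^-1 - floorT x.1^-1)) u1 v1).
  - by rewrite -fxu -fxv -uTD -vTD subrK.
  - by rewrite -fyu -fyv -uTD -vTD -yE'.
  - by rewrite -fxu -fxv -!uTD -!vTD -xE subrK.
  - by rewrite -fyu -fyv -!uTD -!vTD -yE -yE'.
have fl : floorT x.1^-1 = floorT y.1^-1.
  by apply: coordT_inj; rewrite ?fxu ?fyu ?fxv ?fyv ?j ?l.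
rewrite [x]surjective_pairing [y]surjective_pairing; congr pair; apply: invr_inj.
  by rewrite xE yE fl.
by rewrite yE' xE' fl !addrK.
Qed.

(** The digit [(j, l)] of [s] is nonzero because [s] has modulus at least 1, and the conjugate is
    minus the fractional part of [s] minus twice this digit. So it has a coordinate of absolute
    value above [3/2]. *)
Lemma conj_separated_start (R : realType) (s : R[i]) :
  1/2 <= nT s -> interiorX (s - floorT s) ->
  conj_separated (s - floorT s, - s - floorT s).
Proof.
have [fu fv] := coordT_floorT s.
rewrite /conj_separated /interiorX /= !uTB !vTB uTN vTN fu fv /nT.
move: (uT s) (vT s) (Num.floor (uT s + _)) (Num.floor (vT s + _)) {fu fv}.
move=> u v j l n1 [uj vl].
have small : j = 0 -> l = 0 -> False.
  by move=> j0 l0; move: uj vl; rewrite j0 l0 !mulr0z !subr0; nra.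
split=> [|e f ef lens].
  have [j0|[j1|j1]] : j = 0 \/ (1 <= j \/ j <= -1) by clear; lia.
  - have [l0|[l1|l1]] : l = 0 \/ (1 <= l \/ l <= -1) by clear; lia.
    + by case: small.
    + by move: l1; rewrite -(ler_int R) mulr1z; nra.
    + by move: l1; rewrite -(ler_int R) mulrN1z; nra.
  - by move: j1; rewrite -(ler_int R) mulr1z; nra.
  - by move: j1; rewrite -(ler_int R) mulrN1z; nra.
exfalso.
have bound (a b : R) (k g : int) : -(1/2) < a - k%:~R < 1/2 ->
    (- a - k%:~R - g%:~R) ^+ 2 < 1/2 -> -2 < 2 * k + g < 2.
  have kgE : (2 * k + g)%:~R = 2 * k%:~R + g%:~R :> R by rewrite rmorphD rmorphM.
  move=> ak lt; have b1 : - 2%:~R < (2 * k + g)%:~R :> R by rewrite kgE; nra.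
  have b2 : (2 * k + g)%:~R < 2%:~R :> R by rewrite kgE; nra.
  by move: b1 b2; rewrite -rmorphN !ltr_int => -> ->.
have s1 := sqr_ge0 (- u - j%:~R - e%:~R); have s2 := sqr_ge0 (- v - l%:~R - f%:~R).
have bj : -2 < 2 * j + e < 2 by apply: (bound u u j e uj); lra.
have bl : -2 < 2 * l + f < 2 by apply: (bound v v l f vl); lra.
have [je lf] : j = - e /\ l = - f.
  have : ~ (j = 0 /\ l = 0) by case=> /small.
  by clear -ef bj bl; case: (unit_intP ef) bj bl => -[-> ->]; lia.
(* The conjugate differs from the centre [(e, f)] by [- s], so [lens] says that [s] has modulus
   below 1. *)
move: lens; rewrite je lf !rmorphN !opprK !addrK !sqrrN; lra.
Qed.

(** * Finiteness of orbits *)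

(* The domain has a right angle at the corner 1 and lies inside the unit circle, so that
   near this corner the distance to 1 is controlled by the distance to the circle. *)
Lemma corner_dist (R : realFieldType) (x y X Y : R) :
  -x <= y <= x -> x + y <= 1 -> x - y <= 1 -> 1 <= X ^+ 2 + Y ^+ 2 ->
  (x - 1) ^+ 2 + y ^+ 2 <= 12 * ((x - X) ^+ 2 + (y - Y) ^+ 2).
Proof.
(* Expanding [sq] and using [XY] bounds [l * t - l ^+ 2] by [(1 + l) * D]; the left side is largest
   at [l = t / 2]. *)
move=> yx xy xy' XY; pose t := 1 - x; pose l := t / 2.
have t0 : 0 <= t by rewrite /t; lra.
have t1 : t <= 1 by rewrite /t; lra.
have y2 : y ^+ 2 <= t ^+ 2 by rewrite /t; nra.
have z2 : t <= 1 - (x ^+ 2 + y ^+ 2) by rewrite /t; nra.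
set D := (x - X) ^+ 2 + (y - Y) ^+ 2.
have sq : 0 <= (l * x - (X - x)) ^+ 2 + (l * y - (Y - y)) ^+ 2.
  by rewrite addr_ge0 ?sqr_ge0.
have D0 : 0 <= D by rewrite addr_ge0 ?sqr_ge0.
have key : l * (1 - (x ^+ 2 + y ^+ 2)) - l ^+ 2 * (x ^+ 2 + y ^+ 2) <= (1 + l) * D.
  have l0 : 0 <= l by rewrite /l; lra.
  have := ler_wpM2l l0 XY; rewrite /D; nra.
have tD : t ^+ 2 <= 6 * D.
  have n1 : x ^+ 2 + y ^+ 2 <= 1 by lra.
  have h1 : l ^+ 2 * (x ^+ 2 + y ^+ 2) <= l ^+ 2 by rewrite ler_piMr ?sqr_ge0.
  have h2 : l * t <= l * (1 - (x ^+ 2 + y ^+ 2)) by rewrite ler_wpM2l // /l; lra.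
  have h3 : l * D <= 1/2 * D by rewrite ler_wpM2r // /l; lra.
  move: h1 h2 h3 key; rewrite /l; nra.
have -> : (x - 1) ^+ 2 = t ^+ 2 by rewrite /t -sqrrN opprB.
lra.
Qed.

Lemma nTE (R : realType) (z : R[i]) :
  nT z = (complex.Re z ^+ 2 + complex.Im z ^+ 2) / 2.
Proof. by rewrite /nT /uT /vT; field. Qed.

Lemma nTD_le (R : realType) (z w : R[i]) : nT (z + w) <= 2 * nT z + 2 * nT w.
Proof.
case: z w => [a b] [c d]; rewrite !nTE /=.
have := sqr_ge0 (a - c); have := sqr_ge0 (b - d); nra.
Qed.

Lemma nTN (R : realType) (z : R[i]) : nT (- z) = nT z.
Proof. by rewrite /nT uTN vTN !sqrrN. Qed.

(** The diagonals of the plane cut the square into four quarters, one for each corner 1, -1, ['i],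
    [- 'i]; a symmetry of the square reduces each of them to [corner_dist]. *)
Lemma nearest_corner (R : realType) (z w : R[i]) : interiorX z -> 1/2 <= nT w ->
  exists2 e, e \in @gaussian R & nT (e - z) <= 12 * nT (z - w).
Proof.
case: z w => x y [X Y] [] /=; rewrite /uT /vT /= => u v; rewrite nTE /= => XY.
have [xy|xy] := lerP (y ^+ 2) (x ^+ 2); have [x0|x0] := lerP 0 x;
  have [y0|y0] := lerP 0 y.
all: first
 [ exists 1; first (by rewrite rpred1); rewrite !nTE /=;
   have := @corner_dist _ x y X Y; nra
 | exists (-1); first (by rewrite rpredN rpred1); rewrite !nTE /=;
   have := @corner_dist _ (- x) y (- X) Y; nra
 | exists 'i; first (exact: gaussian_i); rewrite !nTE /=;
   have := @corner_dist _ y x Y X; nra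
 | exists (- 'i); first (by rewrite rpredN gaussian_i); rewrite !nTE /=;
   have := @corner_dist _ (- y) x (- Y) X; nra ].
Qed.

Lemma gaussian_nT_ge (R : realType) (z : R[i]) :
  z \in @gaussian R -> z != 0 -> 1/2 <= nT z.
Proof.
move=> /gaussian_intP[p [q ->]] /nT_gt0; rewrite nTE /= => n0.
have : 0%:~R < (p * p + q * q)%:~R :> R.
  by move: n0; rewrite intrD !intrM mulr0z; lra.
rewrite ltr_int gtz0_ge1 -(ler_int R) intrD !intrM mulr1z; lra.
Qed.

Lemma conj_roots_bound (R : realType) (s z w A b C : R[i]) : ~ in_Qi s ->
  conj_roots s z w A b C -> interiorX z -> 1/2 <= nT w ->
  nT A <= (100%:R * nT s) ^+ 2 /\ nT b <= 2 * nT s + 2 * nT A.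
Proof.
move=> irr zw zX w1; have [A0 _ _ _] := conj_roots_neq0 irr zw.
have [[gA gb gC] AC Az Aw] := zw.
have nA := nT_gt0 A0; have nz := interiorX_nT zX.
have bE : b = s - A * z by rewrite Az; ring.
split; last first.
  rewrite bE; apply: le_trans (nTD_le _ _) _; rewrite nTN nTM.
  by have : nT A * nT z <= nT A * (1/2); [apply: ler_wpM2l (ltW nA) _ _ _; lra|lra].
have [e ge ez] := nearest_corner zX w1.
(* The value of the quadratic polynomial at [e]: Gaussian by its coefficients, nonzero because its
   roots are not in Q(i). *)
pose f := A * e ^+ 2 + 2%:R * b * e + C.
have fE : f = A * (e - z) * (e - w).
  apply: (mulfI A0); transitivity ((A * e - A * z) * (A * e - A * w)); last by ring.
  by rewrite Az Aw /f !mulrDr AC; ring.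
have gf : f \in @gaussian R by rewrite /f; gauss.
have f0 : f != 0.
  have irrN : ~ in_Qi (- s) by move/in_QiN.
  rewrite fE !mulf_neq0 ?A0 //; apply/eqP => /eqP; rewrite subr_eq0 => /eqP e0.
    have := gaussian_lin_eq0 (B := A * e + b) irr (rpred1 _) _.
    move=> /(_ ltac:(gauss)); rewrite e0 Az mul1r subrK => /(_ erefl) /eqP.
    by rewrite oner_eq0.
  have := gaussian_lin_eq0 (B := A * e + b) irrN (rpred1 _) _.
  move=> /(_ ltac:(gauss)); rewrite e0 Aw mul1r subrK => /(_ erefl) /eqP.
  by rewrite oner_eq0.
have := gaussian_nT_ge gf f0; rewrite fE !nTM.
have ew : nT (e - w) <= 26%:R * nT (z - w).
  rewrite (_ : e - w = (e - z) + (z - w)); last by ring.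
  apply: le_trans (nTD_le _ _) _; lra.
have dE : nT A * nT (z - w) = 2 * nT s.
  have : nT (A * (z - w)) = nT (2%:R * s) by rewrite mulrBr Az Aw; congr nT; ring.
  rewrite !nTM (_ : nT 2%:R = 2); first lra.
  by rewrite nTE /=; field.
move: ez ew dE.
have ge0 (t : R[i]) : 0 <= nT t by rewrite addr_ge0 ?sqr_ge0.
move: (ge0 (e - z)) (ge0 (e - w)) (ge0 (z - w)).
move: (nT (e - z)) (nT (e - w)) (nT (z - w)) => a1 a2 d a10 a20 d0 ez ew dE le.
have h1 : a1 * a2 <= 312%:R * d ^+ 2.
  by apply: le_trans (ler_pM a10 a20 ez ew) _; lra.
have h2 : nT A * (a1 * a2) <= nT A * (312%:R * d ^+ 2) by rewrite ler_wpM2l // ltW.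
have h3 : (nT A * d) ^+ 2 = 4 * nT s ^+ 2 by rewrite dE; ring.
(* Here [1248 = 4 * 12 * 26]. With [h3] this gives [nT A <= 9984 * nT s ^+ 2], which [100 ^ 2]
   rounds up. *)
have h4 : nT A * (1/2) <= nT A * (1248%:R * nT A * d ^+ 2).
  have le' : 1/2 <= 4 * (nT A * (a1 * a2)) by apply: le_trans le _; lra.
  by apply: ler_wpM2l (ltW nA) _ _ _; apply: le_trans le' _; lra.
move: h3 h4; rewrite !exprMn; have := sqr_ge0 (nT s).
set e1 := nT s ^+ 2; rewrite expr2 -mulrA => *; lra.
Qed.

Lemma pigeonhole (T : finType) (f : nat -> T) :
  exists i j : nat, (i < j)%N /\ f i = f j.
Proof.
pose g (i : 'I_#|T|.+1) := f i.
have /injectivePn[i [j ij gij]] : ~~ injectiveb g.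
  by apply/injectiveP => /leq_card; rewrite card_ord ltnn.
have [lt|lt|e] := ltngtP i j; first by exists i, j.
  by exists j, i.
by case/eqP: ij; apply: val_inj.
Qed.

(** An integer is bounded by its square, so the bound on [p ^+ 2] serves for [p]; adding [N] makes
    it a natural number. *)
Lemma bounded_int_ordinal (R : archiRealFieldType) (M : R) (p : int) :
  p%:~R ^+ 2 <= M -> let N := Num.bound M in
  exists t : 'I_(N + N).+1, p = (t : nat)%:Z - N%:Z.
Proof.
move=> pM N; have M0 : 0 <= M by apply: le_trans pM; apply: sqr_ge0.
have : (p * p)%:~R < N%:Z%:~R :> R.
  by rewrite intrM -expr2; apply: le_lt_trans pM _; apply: archi_boundP.
rewrite ltr_int => pN; have pb : (absz (p + N%:Z)%R < (N + N).+1)%N by nia.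
by exists (Ordinal pb) => /=; nia.
Qed.

Lemma orbit_repeats (R : realType) (s : R[i]) (x : nat -> R[i] * R[i]) : ~ in_Qi s ->
  (forall k, [/\ are_conj s (x k), interiorX (x k).1 & 1/2 <= nT (x k).2]) ->
  exists i j : nat, (i < j)%N /\ x i = x j.
Proof.
(* [M] bounds [nT A], and [M'] bounds [2 * nT] of both [A] and [b], hence the squares of their real
   and imaginary parts. *)
move=> irr Hx; pose M := (100%:R * nT s) ^+ 2; pose M' := 2 * (2 * nT s + 2 * M).
pose N := Num.bound M'; pose I := 'I_(N + N).+1.
pose dec (t : I) : R := ((t : nat)%:Z - N%:Z)%:~R.
pose P k (t : I * I * (I * I)) :=
  let A := dec t.1.1 +i* dec t.1.2 in let b := dec t.2.1 +i* dec t.2.2 in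
  [/\ A != 0, A * (x k).1 = s - b & A * (x k).2 = - s - b].
have [k|f Pf] := @choice _ _ P _.
  have [[A [b [C zw]]] zX w1] := Hx k.
  have [A0 _ _ _] := conj_roots_neq0 irr zw.
  have [bA bb] := conj_roots_bound irr zw zX w1.
  have M0 : 0 <= M by apply: sqr_ge0.
  rewrite -/M in bA.
  have [[gA gb _] _ Az Aw] := zw.
  have n0 : 0 <= nT s by rewrite addr_ge0 ?sqr_ge0.
  have enc (z : R[i]) : z \in @gaussian R -> 2 * nT z <= M' ->
      exists t t' : I, z = dec t +i* dec t'.
    move=> /gaussian_intP[p [q ->]]; rewrite nTE /= => zM.
    have [|t pt] := @bounded_int_ordinal R M' p; first by have := sqr_ge0 (q%:~R : R); lra.
    have [|t' qt] := @bounded_int_ordinal R M' q; first by have := sqr_ge0 (p%:~R : R); lra.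
    by exists t, t'; rewrite pt qt.
  have [||t1 [t2 tA]] := enc A => //; first by rewrite /M'; lra.
  have [||t3 [t4 tb]] := enc b => //; first by rewrite /M'; lra.
  by exists ((t1, t2), (t3, t4)); rewrite /P /= -tA -tb.
have [i [j [ij fij]]] := pigeonhole f; exists i, j; split=> //.
have [A0 Az Aw] := Pf i; have := Pf j; rewrite -fij => -[_ Az' Aw'].
rewrite [x i]surjective_pairing [x j]surjective_pairing.
by congr pair; apply: (mulfI A0); rewrite ?Az ?Az' ?Aw ?Aw'.
Qed.

(** * Pure periodicity of the orbit *)

Lemma tanaka_seq_iter (R : realType) (a : R[i]) (k : nat) :
  (forall k, iter k (@TT R) a != 0) -> tanaka_seq a k = Some (iter k (@TT R) a).
Proof. by move=> a0; elim: k => //= k ->; rewrite (negPf (a0 k)). Qed.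

Theorem theorem6p6 (R : realType) (m n : int) (s : R[i])
  (s_sqrt : s ^+ 2 = m%:~R +i* n%:~R) (s_notin_Qi : ~ in_Qi s) :
  purely_periodic (s - floorT s).
Proof.
set a := s - floorT s; pose x k := iter k (@TT_pair R) (a, - s - floorT s).
have cj_int k : are_conj s (x k) /\ interiorX (x k).1.
  by have [? ? ?] := TT_pair_interior k s_sqrt s_notin_Qi.
have cj k : are_conj s (x k) by case: (cj_int k).
have xX k : interiorX (x k).1 by case: (cj_int k).
have sep k : conj_separated (x k).
  elim: k => [|k IH].
    by apply: conj_separated_start (xX 0%N); apply: nT_sqrt_ge s_sqrt s_notin_Qi.
  exact: (conj_separated_TT s_notin_Qi (cj k) (xX k) (xX k.+1) IH).
have x1 k : (x k).1 = iter k (@TT R) a by elim: k => //= k <-.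
have z0 k : iter k (@TT R) a != 0.
  by rewrite -x1; have [] := are_conj_neq0 s_notin_Qi (cj k).
have [|i [j [ij xij]]] := @orbit_repeats R s x s_notin_Qi.
  by move=> k; split=> //; case: (sep k).
(* Injectivity removes one step from both sides of [x i = x j] until [i] is 0. *)
have per : x (j - i)%N = x 0%N.
  elim: i j ij xij => [|i IH] [|j] // ij xij.
  rewrite subSS; apply: (IH _ ij).
  exact: (TT_pair_inj s_notin_Qi (cj i) (cj j) (xX i) (xX j) (xX i.+1)).
split=> [k|]; first by rewrite tanaka_seq_iter.
exists (j - i)%N => [|k]; first by rewrite subn_gt0.
by rewrite !tanaka_seq_iter // iterD -x1 per x1.
Qed.
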